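(* (1) For any $\lambda\in(0,1)$ and $\mu\in[0,1)$: $\mathbb{L}^{>\lambda}(\mathrm{QBA}|\mathrm{ND})\not\subseteq\mathbb{L}^{>\mu}(\mathrm{QBA}|\mathrm{D})$. (2) For any $\lambda\in[0,1)$: $\mathbb{L}^{=1}(\mathrm{QBA}|\mathrm{ND})\not\subseteq\mathbb{L}^{>\lambda}(\mathrm{QBA}|\mathrm{D})$. (3) For any $\lambda\in[0,1)$: $\mathbb{L}^{=1}(\mathrm{QBA}|\mathrm{D})\not\subseteq\mathbb{L}^{>\lambda}(\mathrm{QBA}|\mathrm{ND})$.
   Context: A quantum automaton is a tuple $\mathcal{A}=(\mathcal{H},|s_0\rangle,\Sigma,\{U_\sigma:\sigma\in\Sigma\},F)$ where $\mathcal{H}$ is a finite-dimensional complex Hilbert space, $|s_0\rangle$ a unit vector, $\Sigma$ a finite alphabet, each $U_\sigma$ unitary, and $F$ a subspace. Let $w=\sigma_1\sigma_2\cdots\in\Sigma^\omega$. Non-disturbing: the run is $|s_n\rangle=U_{\sigma_n}\cdots U_{\sigma_1}|s_0\rangle$ and $f^{\mathrm{ND}}_{\mathcal{A}}(w)=\sup_{|\psi\rangle}\sup_{\{n_i\}}\inf_{i\ge1}|\langle\psi|s_{n_i}\rangle|^2$ (sup over unit $|\psi\rangle\in F$ and strictly increasing sequences $0\le n_1<n_2<\cdots$). Disturbing: for unit $|\psi\rangle\in F$ and checkpoints $\{n_i\}$, the run is $|s_0\rangle$ and for $n\ge1$: $|s_n\rangle=U_{\sigma_n}|\psi\rangle$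 if $n-1=n_i$ for some $i$, else $|s_n\rangle=U_{\sigma_n}|s_{n-1}\rangle$; $f^{\mathrm{D}}_{\mathcal{A}}(w)=\sup_{|\psi\rangle}\sup_{\{n_i\}}\inf_{i\ge1}|\langle\psi|s_{n_i}\rangle|^2$ with this run. For $X\in\{\mathrm{ND},\mathrm{D}\}$: $\mathcal{L}^{>\lambda}(\mathcal{A}|X)=\{w:f^X_{\mathcal{A}}(w)>\lambda\}$, $\mathcal{L}^{=1}(\mathcal{A}|X)=\{w:f^X_{\mathcal{A}}(w)=1\}$, and $\mathbb{L}^{>\lambda}(\mathrm{QBA}|X)$, $\mathbb{L}^{=1}(\mathrm{QBA}|X)$ are the classes of all such languages over all quantum automata $\mathcal{A}$. *)

(* Defs.v *)
From HB Require Import structures.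
From mathcomp Require Import all_boot all_order all_algebra.
From mathcomp Require Import complex.
From mathcomp Require Import boolp classical_sets reals Rstruct.
Set Implicit Arguments.
Unset Strict Implicit.
Unset Printing Implicit Defensive.
Import Order.TTheory GRing.Theory Num.Theory.
Local Open Scope ring_scope.
Local Open Scope classical_set_scope.

Notation RR := Rdefinitions.R.
Notation CC := (complex RR).

Definition adj {m n : nat} (A : 'M[CC]_(m, n)) : 'M[CC]_(n, m) :=
  (map_mx (@conjc _) A)^T.

Definition braket {n : nat} (phi psi : 'cV[CC]_n) : CC :=
  (adj phi *m psi) 0 0.

Definition sqmod (z : CC) : RR := let: Complex a b := z in a ^+ 2 + b ^+ 2.

Definition unit_vec {n : nat} (v : 'cV[CC]_n) : Prop := braket v v = 1.

Definition unitary {n : nat} (U : 'M[CC]_n) : Prop :=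
  adj U *m U = 1%:M /\ U *m adj U = 1%:M.

(* A quantum automaton over the finite alphabet Sigma: Hilbert space C^dim,
   initial unit vector, unitaries U_sigma, and accepting subspace F given as
   the row space of a matrix: |psi> is in F iff (psi^T <= F)%MS. *)
Record QA (Sigma : finType) := MkQA {
  qa_dim : nat;
  qa_s0 : 'cV[CC]_qa_dim;
  qa_U : Sigma -> 'M[CC]_qa_dim;
  qa_F : 'M[CC]_qa_dim;
  qa_s0_unit : unit_vec qa_s0;
  qa_U_unitary : forall s, unitary (qa_U s)
}.

Definition in_F Sigma (A : QA Sigma) (psi : 'cV[CC]_(qa_dim A)) : bool :=
  (psi^T <= qa_F A)%MS.

(* infinite words w = sigma_1 sigma_2 ... : sigma_n is (w n.-1), i.e. w 0 is
   the first letter *)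
Definition word (Sigma : finType) := nat -> Sigma.

(* checkpoint sequences n_1 < n_2 < ... indexed from 0: ns 0 = n_1 *)
Definition strict_incr (ns : nat -> nat) : Prop := forall i, (ns i < ns i.+1)%N.

Fixpoint run_ND Sigma (A : QA Sigma) (w : word Sigma) (n : nat)
  : 'cV[CC]_(qa_dim A) :=
  match n with
  | 0 => qa_s0 A
  | m.+1 => qa_U A (w m) *m run_ND A w m
  end.

(* m is one of the checkpoints ns i (since ns is strictly increasing,
   ns i >= i, so it suffices to look at i <= m) *)
Definition is_checkpoint (ns : nat -> nat) (m : nat) : bool :=
  [exists i : 'I_m.+1, ns i == m].

Fixpoint run_D Sigma (A : QA Sigma) (w : word Sigma)
  (psi : 'cV[CC]_(qa_dim A)) (ns : nat -> nat) (n : nat)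
  : 'cV[CC]_(qa_dim A) :=
  match n with
  | 0 => qa_s0 A
  | m.+1 => qa_U A (w m) *m
             (if is_checkpoint ns m then psi else @run_D Sigma A w psi ns m)
  end.

Definition f_ND Sigma (A : QA Sigma) (w : word Sigma) : RR :=
  sup [set x | exists (psi : 'cV[CC]_(qa_dim A)) (ns : nat -> nat),
         [/\ unit_vec psi, in_F psi, strict_incr ns &
             x = inf [set sqmod (braket psi (@run_ND Sigma A w (ns i))) | i in setT]]].

Definition f_D Sigma (A : QA Sigma) (w : word Sigma) : RR :=
  sup [set x | exists (psi : 'cV[CC]_(qa_dim A)) (ns : nat -> nat),
         [/\ unit_vec psi, in_F psi, strict_incr ns &
             x = inf [set sqmod (braket psi (@run_D Sigma A w psi ns (ns i)))
                     | i in setT]]].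

Inductive mode := ND | D.

Definition f_mode (X : mode) Sigma (A : QA Sigma) : word Sigma -> RR :=
  match X with ND => f_ND A | D => f_D A end.

Definition lang_gt (X : mode) (lambda : RR) Sigma (A : QA Sigma)
  : set (word Sigma) := [set w | lambda < f_mode X A w].
Definition lang_eq1 (X : mode) Sigma (A : QA Sigma)
  : set (word Sigma) := [set w | f_mode X A w = 1].

Definition class_gt (X : mode) (lambda : RR) (Sigma : finType)
  (L : set (word Sigma)) : Prop := exists A : QA Sigma, L = lang_gt X lambda A.
Definition class_eq1 (X : mode) (Sigma : finType)
  (L : set (word Sigma)) : Prop := exists A : QA Sigma, L = lang_eq1 X A.

Definition class_subset (C1 C2 : forall Sigma : finType, set (word Sigma) -> Prop)
  : Prop := forall (Sigma : finType) (L : set (word Sigma)), C1 Sigma L -> C2 Sigma L.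

(* Main.v *)
(**
One automaton, over a two-letter alphabet, separates all the classes: on C^2,
[true] acts as the rotation by the irrational angle of zeta = (3 + 4i)/5,
[false] acts as the identity, and the initial vector spans F.  In both modes it
gives the word false^omega the value 1.

Let B be an automaton accepting false^omega with threshold mu.  The powers of a
unitary are recurrent, so for some N > 0 the vectors U_true^N s and s are as
close as we like, and B cannot tell true^N from the empty word when it reads it
in state s.  With s the initial state, B still accepts true^N false^omega in
either mode, whereas the rotation automaton gives it a value < 1.

To bring the non-disturbing value of the rotation automaton below an arbitrary
lambda > 0, one kick is not enough.  But a disturbing run is reset to psi at
every checkpoint, so B also accepts false^n0 (true^N false^d)^r false^omega for
every r, while the angles of the r kicks add up in the non-disturbing run and
can be made to come close to a right angle.
*)

Require Import Defs.
From HB Require Import structures.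
From mathcomp Require Import all_boot all_order all_algebra.
From mathcomp Require Import complex.
From mathcomp Require Import boolp classical_sets reals Rstruct.
From mathcomp Require Import zify ring lra.
Set Implicit Arguments.
Unset Strict Implicit.
Unset Printing Implicit Defensive.
Import Order.TTheory GRing.Theory Num.Theory.
Local Open Scope ring_scope.

(** * Recurrence of bounded complex families *)

Lemma pigeonhole_nat (T : finType) (g : nat -> T) :
  exists i j, (i < j)%N /\ g i = g j.
Proof.
apply: contrapT => H.
have inj : injective (fun k : 'I_#|T|.+1 => g k).
  move=> x y gxy; apply/val_inj => /=.
  case: (ltngtP x y) => // lt; case: H; first by exists x, y.
  by exists y, x.
by have := leq_card _ inj; rewrite card_ord ltnn.
Qed.

(** For [x] in [-1, 1] the quotient [(x + 1) / e] lies between 0 and [2 / e], so [inord] does not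
    fall back on its default value there. *)
Definition cell (e x : RR) : 'I_(Num.truncn (2 / e)).+1 :=
  inord (Num.truncn ((x + 1) / e)).

Lemma cell_close (e x y : RR) : 0 < e -> `|x| <= 1 -> `|y| <= 1 ->
  cell e x = cell e y -> `|x - y| <= e.
Proof.
move=> e0; rewrite !ler_norml => /andP[x1 x2] /andP[y1 y2].
have bnd t : -1 <= t -> t <= 1 ->
    (Num.truncn ((t + 1) / e) < (Num.truncn (2 / e)).+1)%N.
  move=> t1 t2; rewrite ltnS; apply: le_truncn.
  by rewrite ler_pM2r ?invr_gt0 //; lra.
move=> /(congr1 val); rewrite /cell /= !inordK ?bnd // => E.
have itv t : -1 <= t ->
    (Num.truncn ((t + 1) / e))%:R * e <= t + 1 < ((Num.truncn ((t + 1) / e))%:R + 1) * e.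
  move=> t1; have t0 : 0 <= (t + 1) / e by apply: divr_ge0; [lra | exact: ltW].
  by have := truncn_itv t0; rewrite ler_pdivlMr // ltr_pdivrMr // natr1.
have /andP[a1 a2] := itv _ x1; have /andP[b1 b2] := itv _ y1.
rewrite {}E in a1 a2 *; move: (_%:R) a1 a2 b1 b2 => q; rewrite !mulrDl mul1r.
move: (q * e) => ? *; apply/andP; split; lra.
Qed.

Lemma sqmodE z : sqmod z = Normc.normc z ^+ 2.
Proof. by case: z => a b; rewrite /= sqr_sqrtr ?addr_ge0 ?sqr_ge0. Qed.

Lemma sqmod_ge0 z : 0 <= sqmod z.
Proof. by rewrite sqmodE sqr_ge0. Qed.

Lemma sqmodM x y : sqmod (x * y) = sqmod x * sqmod y.
Proof. by rewrite !sqmodE Normc.normcM exprMn. Qed.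

Lemma sqmodJ z : sqmod (conjc z) = sqmod z.
Proof. by case: z => a b /=; rewrite sqrrN. Qed.

Lemma mulcJ_sqmod z : conjc z * z = (sqmod z)%:C%C.
Proof. by case: z => a b; simpc; congr (_ +i* _)%C; ring. Qed.

Lemma normc_ge0 (z : CC) : 0 <= Normc.normc z.
Proof. by case: z => a b; rewrite sqrtr_ge0. Qed.

Lemma normcJ_eq (z : CC) : Normc.normc (conjc z) = Normc.normc z.
Proof. by case: z => a b /=; rewrite sqrrN. Qed.

Lemma normc_le1 (z : CC) : (Normc.normc z <= 1) = (sqmod z <= 1).
Proof. by rewrite sqmodE expr_le1 ?normc_ge0. Qed.

Lemma normc_sum n (F : 'I_n -> CC) (b : RR) :
  (forall k, Normc.normc (F k) <= b) -> Normc.normc (\sum_k F k) <= n%:R * b.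
Proof.
move=> H; elim: n F H => [|n IH] F H; first by rewrite big_ord0 Normc.normc0 mul0r.
rewrite big_ord_recr /= -natr1 mulrDl mul1r.
by apply: le_trans (le_normcD _ _) _; apply: lerD; rewrite ?IH.
Qed.

Lemma normc_Re_le (z : CC) : `|complex.Re z| <= Normc.normc z.
Proof.
by case: z => a b /=; rewrite -sqrtr_sqr ler_sqrt ?addr_ge0 ?sqr_ge0 ?lerDl ?sqr_ge0.
Qed.

Lemma normc_Im_le (z : CC) : `|complex.Im z| <= Normc.normc z.
Proof.
by case: z => a b /=; rewrite -sqrtr_sqr ler_sqrt ?addr_ge0 ?sqr_ge0 ?lerDr ?sqr_ge0.
Qed.

Lemma normc_le_ReIm (z : CC) :
  Normc.normc z <= `|complex.Re z| + `|complex.Im z|.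
Proof.
case: z => a b /=; rewrite -[leRHS]ger0_norm ?addr_ge0 // -sqrtr_sqr.
rewrite ler_sqrt ?sqr_ge0 // sqrrD !real_normK ?num_real //.
by rewrite -addrA lerD2l lerDr mulrn_wge0 ?mulr_ge0.
Qed.

(** Pigeonhole on the finitely many assignments of cells to the real and imaginary parts of all
    coordinates; width [e / 2] in each part gives [e] in modulus. *)
Lemma bounded_recurrence (I : finType) (z : nat -> I -> CC) (e : RR) : 0 < e ->
  (forall j k, Normc.normc (z j k) <= 1) ->
  exists i j, (i < j)%N /\ forall k, Normc.normc (z j k - z i k) <= e.
Proof.
move=> e0 z1; have e20 : 0 < e / 2 by lra.
have [i [j [ij E]]] := pigeonhole_nat
  (fun j => [ffun k => (cell (e / 2) (complex.Re (z j k)),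
                        cell (e / 2) (complex.Im (z j k)))]).
exists i, j; split=> // k; move: E => /ffunP/(_ k); rewrite !ffunE.
move=> [/esym Er /esym Ei].
have Hr := cell_close e20 (le_trans (normc_Re_le _) (z1 _ _))
  (le_trans (normc_Re_le _) (z1 _ _)) Er.
have Hi := cell_close e20 (le_trans (normc_Im_le _) (z1 _ _))
  (le_trans (normc_Im_le _) (z1 _ _)) Ei.
apply: le_trans (normc_le_ReIm _) _.
have -> : e = e / 2 + e / 2 by lra.
by apply: lerD; [move: Hr | move: Hi]; case: (z j k) => ? ?; case: (z i k).
Qed.

(** Square the triangle inequality |y| >= |x| - |y - x|. If |x| <= |y - x|, the left side of the
    claim is already nonpositive. *)
Lemma sqmod_perturb (x y : CC) : 
  sqmod x - 2 * Normc.normc x * Normc.normc (y - x) <= sqmod y.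
Proof.
have := le_normcD y (x - y); rewrite addrC subrK -(opprB y x) normcN => H.
rewrite !sqmodE; move: (normc_ge0 x) (normc_ge0 y) (normc_ge0 (y - x)) H.
move: (Normc.normc x) (Normc.normc y) (Normc.normc (y - x)) => a b c a0 b0 c0 H.
have [ac|/ltW ca] := lerP a c; first by nra.
have : (a - c) ^+ 2 <= b ^+ 2 by rewrite lerXn2r ?nnegrE //; lra.
nra.
Qed.

(** * Inner products and recurrence of unitaries *)

Section Braket.
Variable n : nat.
Implicit Types (u v : 'cV[CC]_n) (U : 'M[CC]_n).

Lemma braketE u v : braket u v = \sum_k conjc (u k 0) * v k 0.
Proof. by rewrite /braket mxE; apply: eq_bigr => k _; rewrite !mxE. Qed.

Lemma adjM m p q (X : 'M[CC]_(m, p)) (Y : 'M_(p, q)) : adj (X *m Y) = adj Y *m adj X.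
Proof. by rewrite /adj map_mxM trmx_mul. Qed.

Lemma adjK m p (X : 'M[CC]_(m, p)) : adj (adj X) = X.
Proof. by apply/matrixP => i j; rewrite !mxE conjcK. Qed.

Lemma braket_adj u U v : braket u (U *m v) = braket (adj U *m u) v.
Proof. by rewrite /braket adjM adjK mulmxA. Qed.

Lemma unitary_adj U : unitary U -> unitary (adj U).
Proof. by case=> ? ?; split; rewrite adjK. Qed.

Lemma braket_unitary U u v : unitary U -> braket (U *m u) (U *m v) = braket u v.
Proof. by case=> H _; rewrite braket_adj mulmxA H mul1mx. Qed.

Lemma braketB u v v' : braket u (v - v') = braket u v - braket u v'.
Proof. by rewrite /braket mulmxBr !mxE. Qed.

Lemma unit_vec_mul U u : unitary U -> unit_vec u -> unit_vec (U *m u).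
Proof. by move=> HU; rewrite /unit_vec braket_unitary. Qed.

Lemma braket_iter U u v k : unitary U ->
  braket (iter k (mulmx U) u) (iter k (mulmx U) v) = braket u v.
Proof. by move=> HU; elim: k => //= k IH; rewrite braket_unitary. Qed.

Lemma unit_vec_iter U u k : unitary U -> unit_vec u -> unit_vec (iter k (mulmx U) u).
Proof. by move=> HU; rewrite /unit_vec braket_iter. Qed.

Lemma braket_iter_adj u U v k :
  braket u (iter k (mulmx U) v) = braket (iter k (mulmx (adj U)) u) v.
Proof. by elim: k u => //= k IH u; rewrite braket_adj IH -iterS iterSr. Qed.

Lemma iter_mulmxB U u v k :
  iter k (mulmx U) (u - v) = iter k (mulmx U) u - iter k (mulmx U) v.
Proof. by elim: k => //= k ->; rewrite mulmxBr. Qed.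

Lemma unit_vec_entry u k : unit_vec u -> Normc.normc (u k 0) <= 1.
Proof.
rewrite /unit_vec braketE normc_le1.
under eq_bigr do rewrite mulcJ_sqmod.
rewrite -rmorph_sum => -[] <-.
by rewrite (bigD1 k) //= lerDl sumr_ge0 // => i _; apply: sqmod_ge0.
Qed.

(** Entrywise estimate, cruder than Cauchy-Schwarz by a factor depending on [n]; this is harmless
    because [b] will be chosen small in terms of [n]. *)
Lemma normc_braket u v (b : RR) : unit_vec u ->
  (forall k, Normc.normc (v k 0) <= b) -> Normc.normc (braket u v) <= n%:R * b.
Proof.
move=> Hu Hv; rewrite braketE; apply: normc_sum => k.
rewrite Normc.normcM normcJ_eq -[b]mul1r.
by apply: ler_pM; rewrite ?normc_ge0 ?unit_vec_entry.
Qed.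

Lemma normc_braket_unit u v : unit_vec u -> unit_vec v ->
  Normc.normc (braket u v) <= n%:R.
Proof.
by move=> Hu Hv; rewrite -[n%:R]mulr1 normc_braket // => k; apply: unit_vec_entry.
Qed.

(** By pigeonhole U^i v and U^j v are entrywise close for some i < j. With N = j - i, invariance of
    the inner product gives <u, U^N v - v> = <U^i u, U^j v - U^i v>. Since [N] does not depend on
    [u], one [N] can serve all checkpoints at once. *)
Lemma unitary_recurrence U v (e : RR) : unitary U -> unit_vec v -> 0 < e ->
  exists N, (0 < N)%N /\ forall u, unit_vec u ->
    sqmod (braket u v) - e <= sqmod (braket u (iter N (mulmx U) v)).
Proof.
(* The perturbation costs at most 2 * n * (n * d), hence the factor 2 n^2; the added 1 keeps the
   denominator positive for n = 0. *)
move=> HU Hv e0; pose d := e / (2 * n%:R ^+ 2 + 1).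
have D0 : 0 < 2 * n%:R ^+ 2 + 1 :> RR by have := sqr_ge0 (n%:R : RR); lra.
have d0 : 0 < d by rewrite divr_gt0.
have [i [j [ij H]]] := bounded_recurrence d0
  (fun j k => unit_vec_entry k (unit_vec_iter j HU Hv)).
exists (j - i)%N; rewrite subn_gt0; split=> // u Hu.
apply: le_trans _ (sqmod_perturb (braket u v) _); rewrite lerD2l lerN2.
rewrite -braketB -(braket_iter u (_ - _) i HU).
have -> : iter i (mulmx U) (iter (j - i) (mulmx U) v - v)
        = iter j (mulmx U) v - iter i (mulmx U) v.
  by rewrite iter_mulmxB -iterD subnKC // ltnW.
have Hb : Normc.normc (braket (iter i (mulmx U) u)
    (iter j (mulmx U) v - iter i (mulmx U) v)) <= n%:R * d.
  by apply: normc_braket (unit_vec_iter i HU Hu) _ => k; rewrite !mxE.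
apply: (@le_trans _ _ (2 * n%:R * (n%:R * d))).
  by apply: ler_pM; rewrite ?mulr_ge0 ?normc_ge0 ?ler_pM2l ?normc_braket_unit.
have -> : e = (2 * n%:R ^+ 2 + 1) * d by rewrite /d mulrC divfK ?gt_eqF.
have -> : 2 * n%:R * (n%:R * d) = (2 * n%:R ^+ 2) * d by ring.
by rewrite ler_pM2r // lerDl.
Qed.
End Braket.

(** * Powers of unit complex numbers and the irrational angle of [zeta] *)

Lemma Re_mulc (x y : CC) : complex.Re (x * y) =
  complex.Re x * complex.Re y - complex.Im x * complex.Im y.
Proof. by case: x => ? ?; case: y. Qed.

Lemma Im_mulc (x y : CC) : complex.Im (x * y) =
  complex.Re x * complex.Im y + complex.Im x * complex.Re y.
Proof. by case: x => ? ?; case: y. Qed.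

Lemma Re_subc (x y : CC) : complex.Re (x - y) = complex.Re x - complex.Re y.
Proof. by case: x => ? ?; case: y. Qed.

Lemma sqmod_ReIm (x : CC) : sqmod x = complex.Re x ^+ 2 + complex.Im x ^+ 2.
Proof. by case: x. Qed.

Lemma sqmodX (x : CC) n : sqmod x = 1 -> sqmod (x ^+ n) = 1.
Proof.
move=> x1; elim: n => [|n IH]; last by rewrite exprS sqmodM x1 IH mul1r.
by rewrite expr0 /= expr1n expr0n addr0.
Qed.

Definition zeta : CC := Complex (3 / 5) (4 / 5).

Lemma sqmod_zeta : sqmod zeta = 1.
Proof. by rewrite /=; lra. Qed.

(* Modulo 5, 3 + 4i is idempotent, so no positive power of it is real. *)
Lemma zeta_exp_mod5 n : exists k l : int,
  complex.Re (zeta ^+ n.+1) * 5 ^+ n.+1 = (5 * k + 3)%:~R /\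
  complex.Im (zeta ^+ n.+1) * 5 ^+ n.+1 = (5 * l + 4)%:~R.
Proof.
elim: n => [|n [k [l [Hk Hl]]]].
  by exists 0, 0; rewrite !expr1 /=; split; rewrite mulr0 add0r; lra.
(* (3 + 4i)^2 = -7 + 24i, and -7 = 5 * (-2) + 3, 24 = 5 * 4 + 4; this is where -2 and 4 come
   from. *)
exists (3 * k - 4 * l - 2), (4 * k + 3 * l + 4).
have -> : 5 * (3 * k - 4 * l - 2) + 3 = 3 * (5 * k + 3) - 4 * (5 * l + 4) by ring.
have -> : 5 * (4 * k + 3 * l + 4) + 4 = 4 * (5 * k + 3) + 3 * (5 * l + 4) by ring.
rewrite [(_ - _)%:~R]rmorphB [(4 * _ + _)%:~R]rmorphD !rmorphM /= -Hk -Hl.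
rewrite exprS [5 ^+ n.+2]exprS Re_mulc Im_mulc /=.
move: (complex.Re _) (complex.Im _) (5 ^+ _) => x y z.
by split; field.
Qed.

Lemma Im_zeta_exp n : (0 < n)%N -> complex.Im (zeta ^+ n) != 0.
Proof.
case: n => // n _; have [_ [l [_ Hl]]] := zeta_exp_mod5 n.
apply/eqP => H; move: Hl; rewrite H mul0r => /esym/eqP; rewrite intr_eq0.
by move=> /eqP; lia.
Qed.

Lemma Re_sq_lt1 (x : CC) : sqmod x = 1 -> complex.Im x != 0 ->
  complex.Re x ^+ 2 < 1.
Proof.
rewrite sqmod_ReIm => H; rewrite -sqrf_eq0 => I0.
by have := sqr_ge0 (complex.Im x); rewrite le0r (negbTE I0) /=; lra.
Qed.

(* While the real parts stay positive, squaring at least doubles [1 - Re]. *)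
Lemma exists_Re_exp_le0 (x : CC) : sqmod x = 1 -> complex.Im x != 0 ->
  exists r, complex.Re (x ^+ r) <= 0.
Proof.
move=> x1 I0; apply: contrapT => H.
have pos r : 0 < complex.Re (x ^+ r).
  by rewrite ltNge; apply/negP => Hr; apply: H; exists r.
have D k : (2 ^ k)%:R * (1 - complex.Re x) <= 1 - complex.Re (x ^+ (2 ^ k)).
  elim: k => [|k IH]; first by rewrite expr1 mul1r.
  (* If c + is is the current power, its square has real part c^2 - s^2 = 2 c^2 - 1, and 1 - (2 c^2
     - 1) = 2 (1 - c) (1 + c) >= 2 (1 - c) for 0 < c <= 1. *)
  rewrite expnS natrM -mulrA mul2n -addnn exprD Re_mulc.
  have := pos (2 ^ k)%N; have := sqmodX (2 ^ k) x1; rewrite sqmod_ReIm.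
  move: IH; move: (complex.Re (x ^+ _)) (complex.Im (x ^+ _)) (_ * _) => c s b.
  by nra.
have lt1 : 0 < 1 - complex.Re x.
  by have := Re_sq_lt1 x1 I0; have := pos 1%N; rewrite expr1; nra.
(* As 2^k > k > 1 / (1 - Re x), the doubling forces 1 - Re (x^(2^k)) > 1, against positivity. *)
pose k := (Num.truncn (1 - complex.Re x)^-1).+1; have {}D := D k.
have Hk : 1 < k%:R * (1 - complex.Re x).
  by rewrite -ltr_pdivrMr // div1r /k truncnS_gt.
have : k%:R * (1 - complex.Re x) <= (2 ^ k)%:R * (1 - complex.Re x).
  by rewrite ler_pM2r // ler_nat ltnW // ltn_expl.
move=> /(lt_le_trans Hk)/lt_le_trans/(_ D).
by rewrite ltrBrDr gtrDl ltNge (ltW (pos _)).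
Qed.

(** Recurrence yields a power x of y with |x - 1| <= lam, so the real parts of successive powers of
    x move by at most lam. They start at 1 and reach a value <= 0. If all their squares exceeded
    lam, the change of sign would need a jump larger than 2 sqrt(lam) > lam. *)
Lemma exists_Re_sq_le (y : CC) (lam : RR) : 0 < lam < 1 -> sqmod y = 1 ->
  (forall n, (0 < n)%N -> complex.Im (y ^+ n) != 0) ->
  exists r, complex.Re (y ^+ r) ^+ 2 <= lam.
Proof.
move=> /andP[l0 l1] y1 Iy.
have ny j : Normc.normc (y ^+ j) <= 1 by rewrite normc_le1 sqmodX.
have [i [j [ij /(_ tt) H]]] :=
  bounded_recurrence (I := unit) l0 (fun j _ => ny j).
pose x := y ^+ (j - i); have x1 : sqmod x = 1 by apply: sqmodX.
have [r Hr] : exists r, complex.Re (x ^+ r) <= 0.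
  by apply: exists_Re_exp_le0 => //; rewrite Iy // subn_gt0.
have step k : `|complex.Re (x ^+ k.+1) - complex.Re (x ^+ k)| <= lam.
  rewrite -Re_subc; apply: le_trans (normc_Re_le _) _.
  have -> : x ^+ k.+1 - x ^+ k = x ^+ k * (x - 1) by rewrite exprSr; ring.
  rewrite Normc.normcM; apply: le_trans H.
  have -> : y ^+ j - y ^+ i = y ^+ i * (x - 1).
    by rewrite mulrBr mulr1 -exprD subnKC // ltnW.
  rewrite Normc.normcM ler_wpM2r ?normc_ge0 //.
  rewrite -(@ler_pXn2r _ 2) ?nnegrE ?normc_ge0 // -!sqmodE !sqmodX //.
apply: contrapT => Hn.
have big k : lam < complex.Re (x ^+ k) ^+ 2.
  rewrite ltNge; apply/negP => Hk; apply: Hn.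
  by exists ((j - i) * k)%N; rewrite exprM.
have : 0 < complex.Re (x ^+ r).
  elim: (r) => [|k IH]; first by rewrite expr0 ltr01.
  have := step k; rewrite ler_norml => /andP[S1 S2].
  have := big k; have := big k.+1.
  by rewrite ltNge; case: lerP => //; nra.
by rewrite ltNge Hr.
Qed.

(** * Suprema of infima, common to both modes *)

Section Score.
Variables (Sigma : finType) (A : QA Sigma).
Variable val : 'cV[CC]_(qa_dim A) -> (nat -> nat) -> nat -> RR.
Hypothesis val_ge0 : forall psi ns i, 0 <= val psi ns i.

(* [f_ND A w] and [f_D A w] are both, definitionally, of this form. *)
Definition score : RR :=
  sup [set x | exists psi ns, [/\ unit_vec psi, in_F psi, strict_incr ns &
                 x = inf [set val psi ns i | i in setT]]]%classic.

Lemma inf_val_le psi ns i :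
  inf [set val psi ns i | i in setT]%classic <= val psi ns i.
Proof.
apply: ge_inf; last by exists i.
by exists 0 => _ [k _ <-].
Qed.

(** If F contains no unit vector, the set is empty and its [sup] is 0 by default; [0 <= c] covers
    this case. *)
Lemma score_le c : 0 <= c ->
  (forall psi ns, unit_vec psi -> in_F psi -> strict_incr ns ->
     exists i, val psi ns i <= c) ->
  score <= c.
Proof.
move=> c0 H; rewrite /score; set S := (X in sup X).
have ub : ubound S c.
  move=> _ [psi [ns [u f s ->]]]; have [i Hi] := H psi ns u f s.
  exact: le_trans (inf_val_le _ _ _) Hi.
have [S0|/set0P S0] := eqVneq S set0; first by rewrite S0 sup0.
exact: ge_sup.
Qed.

(** [0 <= mu] excludes the empty set, whose [sup] is 0. The gap between [mu] and the infimum [c] is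
    the room later spent on perturbations. *)
Lemma score_gt_elim mu : 0 <= mu -> mu < score ->
  exists psi ns c, [/\ unit_vec psi, in_F psi, strict_incr ns, mu < c &
    forall i, c <= val psi ns i].
Proof.
move=> mu0 H; have [S0|/set0P S0] := eqVneq
  [set x | exists psi ns, [/\ unit_vec psi, in_F psi, strict_incr ns &
      x = inf [set val psi ns i | i in setT]]]%classic set0.
  by move: H; rewrite /score S0 sup0 ltNge mu0.
have [_ [psi [ns [u f s ->]]] Hc] := sup_gt S0 H.
exists psi, ns, (inf [set val psi ns i | i in setT]%classic).
by split=> // i; apply: inf_val_le.
Qed.

(** The bound [K], of any size, makes the set bounded above, so that [sup] dominates its members. *)
Lemma score_ge K c psi ns :
  (forall psi ns i, unit_vec psi -> val psi ns i <= K) ->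
  unit_vec psi -> in_F psi -> strict_incr ns ->
  (forall i, c <= val psi ns i) -> c <= score.
Proof.
move=> HK u f s Hc; apply: (@le_trans _ _ (inf [set val psi ns i | i in setT]%classic)).
  by apply: lb_le_inf; [exists (val psi ns 0), 0%N | move=> _ [i _ <-]].
apply: ub_le_sup; last by exists psi, ns.
exists K => _ [psi' [ns' [u' _ _ ->]]].
exact: le_trans (inf_val_le _ _ 0) (HK _ _ _ u').
Qed.

End Score.

(** * Runs cut at checkpoints into undisturbed evolutions *)

Section Runs.
Variables (Sigma : finType) (A : QA Sigma).
Implicit Types (w : word Sigma) (v psi : 'cV[CC]_(qa_dim A)) (ns : nat -> nat).

(** The starting position and vector are free so that each segment of a disturbing run, restarted
    from psi, is again such an evolution. *)
Fixpoint evolve w m k v : 'cV[CC]_(qa_dim A) :=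
  if k is k'.+1 then qa_U A (w (m + k')%N) *m evolve w m k' v else v.

Lemma run_ND_evolve w n : run_ND A w n = evolve w 0 n (qa_s0 A).
Proof. by elim: n => //= n ->. Qed.

Lemma eq_evolve w m w' m' k v :
  (forall i, (i < k)%N -> w (m + i)%N = w' (m' + i)%N) ->
  evolve w m k v = evolve w' m' k v.
Proof.
elim: k => //= k IH H; rewrite H // IH // => i ik.
by apply: H; apply: ltnW.
Qed.

Lemma evolveD w m j k v :
  evolve w m (j + k) v = evolve w (m + j) k (evolve w m j v).
Proof. by elim: k => [|k IH]; rewrite ?addn0 // addnS /= IH addnA. Qed.

Lemma evolve_const w m k v a : (forall i, (i < k)%N -> w (m + i)%N = a) ->
  evolve w m k v = iter k (mulmx (qa_U A a)) v.
Proof.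
elim: k => //= k IH H; rewrite H // IH // => i ik.
by apply: H; apply: ltnW.
Qed.

Lemma unit_vec_evolve w m k v : unit_vec v -> unit_vec (evolve w m k v).
Proof.
by move=> Hv; elim: k => //= k IH; apply: unit_vec_mul => //; apply: qa_U_unitary.
Qed.

Lemma strict_incr_lt ns i j : strict_incr ns -> (i < j)%N -> (ns i < ns j)%N.
Proof.
move=> H; elim: j => // j IH; rewrite ltnS leq_eqVlt => /orP[/eqP->|/IH] //.
by move=> /ltn_trans; apply.
Qed.

Lemma strict_incr_ge ns i : strict_incr ns -> (i <= ns i)%N.
Proof. by move=> H; elim: i => // i IH; apply: leq_ltn_trans IH (H i). Qed.

Lemma is_checkpointP ns m : strict_incr ns ->
  reflect (exists i, ns i = m) (is_checkpoint ns m).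
Proof.
move=> H; apply: (iffP existsP) => [[i /eqP <-]|[i Hi]]; first by exists i.
have im : (i < m.+1)%N by rewrite ltnS -Hi strict_incr_ge.
by exists (Ordinal im); apply/eqP.
Qed.

Lemma run_D_first w psi ns : strict_incr ns ->
  run_D w psi ns (ns 0) = evolve w 0 (ns 0) (qa_s0 A).
Proof.
move=> H; suff G n : (n <= ns 0)%N -> run_D w psi ns n = evolve w 0 n (qa_s0 A).
  exact: G.
elim: n => //= n IH n0; case: is_checkpointP => // [[i Hi]|_]; last first.
  by rewrite IH // ltnW.
case: i Hi => [|i] Hi; first by rewrite -Hi ltnn in n0.
have := @strict_incr_lt ns 0 i.+1 H isT; lia.
Qed.

Lemma run_D_next w psi ns i : strict_incr ns ->
  run_D w psi ns (ns i.+1) = evolve w (ns i) (ns i.+1 - ns i) psi.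
Proof.
move=> H; have Hi := H i.
(* At [ns i] itself the run still holds the vector before the reset, which acts only in the step
   leaving [ns i]; hence [k.+1]. *)
suff G k : (k < ns i.+1 - ns i)%N ->
    run_D w psi ns (ns i + k.+1)%N = evolve w (ns i) k.+1 psi.
  have -> : ns i.+1 = (ns i + (ns i.+1 - ns i).-1.+1)%N by lia.
  by rewrite G; [congr evolve; lia | lia].
elim: k => [_|k IH kn]; rewrite addnS /=.
  rewrite addn0; case: is_checkpointP => // Hn.
  by case: Hn; exists i.
rewrite addnS in IH; case: is_checkpointP => // [[j Hj]|_].
  have [ji|ij] := leqP j i.
    have : (ns j <= ns i)%N.
      by move: ji; rewrite leq_eqVlt => /orP[/eqP->|/(strict_incr_lt H)/ltnW].
    by lia.
  have : (ns i.+1 <= ns j)%N.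
    by move: ij; rewrite leq_eqVlt => /orP[/eqP->|/(strict_incr_lt H)/ltnW].
  by lia.
by rewrite addnS IH // ltnW.
Qed.

Lemma unit_vec_run_D w psi ns n : unit_vec psi -> unit_vec (run_D w psi ns n).
Proof.
move=> Hp; elim: n => [|n IH] /=; first exact: qa_s0_unit.
by apply: unit_vec_mul; [apply: qa_U_unitary | case: ifP].
Qed.

Lemma sqmod_braket_le (u v : 'cV[CC]_(qa_dim A)) : unit_vec u -> unit_vec v ->
  sqmod (braket u v) <= (qa_dim A)%:R ^+ 2.
Proof.
by move=> Hu Hv; rewrite sqmodE lerXn2r ?nnegrE ?normc_ge0 ?normc_braket_unit.
Qed.

Lemma f_ND_gt_elim w mu : 0 <= mu -> mu < f_ND A w ->
  exists psi ns c, [/\ unit_vec psi, in_F psi, strict_incr ns, mu < c &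
    forall i, c <= sqmod (braket psi (evolve w 0 (ns i) (qa_s0 A)))].
Proof.
move=> mu0 /(score_gt_elim (fun _ _ _ => sqmod_ge0 _) mu0).
move=> [psi [ns [c [? ? ? ? H]]]]; exists psi, ns, c; split=> // i.
by rewrite -run_ND_evolve.
Qed.

Lemma f_ND_ge w psi ns c : unit_vec psi -> in_F psi -> strict_incr ns ->
  (forall i, c <= sqmod (braket psi (evolve w 0 (ns i) (qa_s0 A)))) ->
  c <= f_ND A w.
Proof.
move=> u f s H; apply: (score_ge (fun _ _ _ => sqmod_ge0 _)
  (K := (qa_dim A)%:R ^+ 2) (psi := psi) (ns := ns)) => // [psi' ns' i u'|i].
  rewrite run_ND_evolve; apply: sqmod_braket_le => //.
  exact/unit_vec_evolve/qa_s0_unit.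
by rewrite run_ND_evolve.
Qed.

Lemma f_ND_le w c : 0 <= c ->
  (forall psi ns, unit_vec psi -> in_F psi -> strict_incr ns ->
     exists i, sqmod (braket psi (evolve w 0 (ns i) (qa_s0 A))) <= c) ->
  f_ND A w <= c.
Proof.
move=> c0 H; apply: score_le => // [psi ns i|psi ns u f s].
  exact: sqmod_ge0.
by have [i Hi] := H psi ns u f s; exists i; rewrite run_ND_evolve.
Qed.

Lemma f_D_gt_elim w mu : 0 <= mu -> mu < f_D A w ->
  exists psi ns c, [/\ unit_vec psi, in_F psi, strict_incr ns & [/\ mu < c,
    c <= sqmod (braket psi (evolve w 0 (ns 0) (qa_s0 A))) &
    forall i, c <= sqmod (braket psi (evolve w (ns i) (ns i.+1 - ns i) psi))]].
Proof.
move=> mu0 /(score_gt_elim (fun _ _ _ => sqmod_ge0 _) mu0).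
move=> [psi [ns [c [? ? ? ? H]]]]; exists psi, ns, c; split=> //; split=> // [|i].
  by rewrite -(run_D_first _ psi).
by rewrite -run_D_next.
Qed.

Lemma f_D_ge w psi ns c : unit_vec psi -> in_F psi -> strict_incr ns ->
  c <= sqmod (braket psi (evolve w 0 (ns 0) (qa_s0 A))) ->
  (forall i, c <= sqmod (braket psi (evolve w (ns i) (ns i.+1 - ns i) psi))) ->
  c <= f_D A w.
Proof.
move=> u f s H0 H; apply: (score_ge (fun _ _ _ => sqmod_ge0 _)
  (K := (qa_dim A)%:R ^+ 2) (psi := psi) (ns := ns)) => // [psi' ns' i u'|[|i]].
- by apply: sqmod_braket_le => //; apply: unit_vec_run_D.
- by rewrite run_D_first.
- by rewrite run_D_next.
Qed.

Lemma f_D_le w c : 0 <= c ->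
  (forall psi ns, unit_vec psi -> in_F psi -> strict_incr ns ->
     sqmod (braket psi (evolve w 0 (ns 0) (qa_s0 A))) <= c \/
     exists i, sqmod (braket psi (evolve w (ns i) (ns i.+1 - ns i) psi)) <= c) ->
  f_D A w <= c.
Proof.
move=> c0 H; apply: score_le => // [psi ns i|psi ns u f s].
  exact: sqmod_ge0.
have [Hi|[i Hi]] := H psi ns u f s; first by exists 0; rewrite run_D_first.
by exists i.+1; rewrite run_D_next.
Qed.

End Runs.

(** * The rotation automaton *)

(** Multiplication by z on the complex plane, read as the real plane inside C^2 through [rvec]; runs
    thus become powers of [zeta]. *)
Definition rotm (z : CC) : 'M[CC]_2 := \matrix_(i, j)
  (if i == j then complex.Re z
   else if i == 0 then - complex.Im z else complex.Im z)%:C%C.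

Definition rvec (z : CC) : 'cV[CC]_2 :=
  \col_i (if i == 0 then complex.Re z else complex.Im z)%:C%C.

Lemma ord2P (i : 'I_2) : i = 0 \/ i = 1.
Proof. by case: i => [[|[|]]] // ?; [left | right]; apply: val_inj. Qed.

Lemma rotm_rvec z y : rotm z *m rvec y = rvec (z * y).
Proof.
apply/matrixP => i j; rewrite !mxE !big_ord_recl big_ord0 !mxE addr0 Re_mulc Im_mulc.
by have [->|->] := ord2P i; rewrite /= -!rmorphM -rmorphD /= ?mulNr // addrC.
Qed.

Lemma unitary_rotm z : sqmod z = 1 -> unitary (rotm z).
Proof.
rewrite sqmod_ReIm => z1.
split; apply/matrixP => i j; rewrite !mxE !big_ord_recl big_ord0 !mxE addr0;
  have [->|->] := ord2P i; have [->|->] := ord2P j; simpc;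
  by congr (_ +i* _)%C; rewrite -?z1; ring.
Qed.

Lemma unitary1 n : unitary (1%:M : 'M[CC]_n).
Proof.
have a1 : adj (1%:M : 'M[CC]_n) = 1%:M by rewrite /adj map_mx1 trmx1.
by split; rewrite a1 mul1mx.
Qed.

Lemma braket_rvec (a b y : CC) :
  braket (a *: rvec 1) (b *: rvec y) = conjc a * b * (complex.Re y)%:C%C.
Proof.
rewrite braketE !big_ord_recl big_ord0 !mxE /= addr0.
by case: a b => ? ? [? ?]; simpc; congr (_ +i* _)%C; ring.
Qed.

Lemma sqmod_braket_rvec (a b y : CC) : sqmod a = 1 -> sqmod b = 1 ->
  sqmod (braket (a *: rvec 1) (b *: rvec y)) = complex.Re y ^+ 2.
Proof.
move=> a1 b1; rewrite braket_rvec !sqmodM sqmodJ a1 b1 !mul1r.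
by rewrite /= expr0n addr0.
Qed.

Lemma sqmod1 : sqmod 1 = 1.
Proof. by rewrite /= expr1n expr0n addr0. Qed.

Lemma unit_vec_rvec1 : unit_vec (rvec 1).
Proof. by rewrite /unit_vec -[rvec 1]scale1r braket_rvec conjc1 !mul1r. Qed.

Lemma rotA_unitary (s : bool) : unitary (if s then rotm zeta else 1%:M).
Proof. by case: s; [apply/unitary_rotm/sqmod_zeta | apply: unitary1]. Qed.

Definition rotA : QA bool := @MkQA bool 2 (rvec 1) _ (delta_mx 0 0)
  unit_vec_rvec1 rotA_unitary.

(** F is the line of [rvec 1], so the choice of psi is only a phase, which squared moduli do not
    see. *)
Lemma in_F_rotA (psi : 'cV[CC]_(qa_dim rotA)) : unit_vec psi -> in_F psi ->
  exists2 a, sqmod a = 1 & psi = a *: rvec 1.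
Proof.
move=> u /submxP[M /matrixP/(_ 0 1)]; rewrite /= !mxE big1 => [p1|i _]; last first.
  by rewrite !mxE andbF mulr0.
have E : psi = psi 0 0 *: rvec 1.
  apply/matrixP => i j; rewrite !mxE !ord1.
  by have [->|->] := ord2P i; rewrite ?p1 /= ?mulr1 ?mulr0.
exists (psi 0 0) => //; move: u; rewrite /unit_vec E braket_rvec mulr1.
by rewrite !mxE mulr1 mulcJ_sqmod => -[].
Qed.

Lemma in_F_rvec1 : in_F (rvec 1 : 'cV[CC]_(qa_dim rotA)).
Proof.
apply/submxP; exists (rvec 1)^T; apply/matrixP => i j.
rewrite !mxE !big_ord_recl big_ord0 !mxE.
by have [->|->] := ord2P j; simpc.
Qed.

(** Only the number of letters [true] in the segment matters. *)
Lemma evolve_rotA (w : word bool) m k (b y : CC) :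
  evolve (A := rotA) w m k (b *: rvec y) =
  b *: rvec (zeta ^+ (\sum_(i < k) w (m + i)%N) * y).
Proof.
elim: k => [|k IH] /=; first by rewrite big_ord0 mul1r.
rewrite IH big_ord_recr /=; case: (w _); last by rewrite mul1mx addn0.
by rewrite -scalemxAr rotm_rvec addn1 exprS mulrA.
Qed.

Lemma sqmod_evolve_rotA (w : word bool) m k (a b : CC) :
  sqmod a = 1 -> sqmod b = 1 ->
  sqmod (braket (a *: rvec 1) (evolve (A := rotA) w m k (b *: rvec 1))) =
  complex.Re (zeta ^+ (\sum_(i < k) w (m + i)%N)) ^+ 2.
Proof. by move=> a1 b1; rewrite evolve_rotA sqmod_braket_rvec // mulr1. Qed.

Lemma qa_s0_rotA : qa_s0 rotA = 1 *: rvec 1.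
Proof. by rewrite scale1r. Qed.

Definition rest : word bool := fun=> false.

Lemma sqmod_evolve_rest m k (a b : CC) : sqmod a = 1 -> sqmod b = 1 ->
  sqmod (braket (a *: rvec 1) (evolve (A := rotA) rest m k (b *: rvec 1))) = 1.
Proof. by move=> a1 b1; rewrite sqmod_evolve_rotA // big1 // expr1n. Qed.

Lemma f_ND_rest : f_ND rotA rest = 1.
Proof.
apply/le_anti/andP; split.
  apply: f_ND_le => // psi ns /in_F_rotA u /u[a a1 ->] s; exists 0%N.
  by rewrite qa_s0_rotA sqmod_evolve_rest ?sqmod1.
apply: (@f_ND_ge _ rotA _ (rvec 1) id) => //.
- exact: unit_vec_rvec1.
- exact: in_F_rvec1.
- by move=> i; rewrite qa_s0_rotA -[X in braket X]scale1r sqmod_evolve_rest ?sqmod1.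
Qed.

Lemma f_D_rest : f_D rotA rest = 1.
Proof.
apply/le_anti/andP; split.
  apply: f_D_le => // psi ns /in_F_rotA u /u[a a1 ->] s; left.
  by rewrite qa_s0_rotA sqmod_evolve_rest ?sqmod1.
apply: (@f_D_ge _ rotA _ (rvec 1) id) => //.
- exact: unit_vec_rvec1.
- exact: in_F_rvec1.
- by rewrite qa_s0_rotA -[X in braket X]scale1r sqmod_evolve_rest ?sqmod1.
- by move=> i; rewrite -[rvec 1]scale1r sqmod_evolve_rest ?sqmod1.
Qed.

(** * Single and repeated kicks *)

Definition kick (N : nat) : word bool := fun n => (n < N)%N.

Lemma sum_kick N k : (\sum_(i < k) kick N (0 + i) = minn k N)%N.
Proof.
by elim: k => [|k IH]; rewrite ?big_ord0 ?min0n // big_ord_recr /= IH /kick; lia.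
Qed.

Lemma evolve_kick (B : QA bool) N k v :
  evolve (A := B) (kick N) 0 (N + k) v =
  iter k (mulmx (qa_U B false)) (iter N (mulmx (qa_U B true)) v).
Proof.
rewrite evolveD (evolve_const _ (a := false)); last by move=> i _; rewrite /kick; lia.
by rewrite (evolve_const _ (a := true)).
Qed.

(** Since [ns N >= N], the checkpoint of index N comes after the whole kick, where the value is
    cos^2 of N times the angle, whatever psi and [ns] are. *)
Lemma f_ND_kick_lt1 N : (0 < N)%N -> f_ND rotA (kick N) < 1.
Proof.
move=> N0; apply: le_lt_trans (Re_sq_lt1 (sqmodX N sqmod_zeta) (Im_zeta_exp N0)).
apply: f_ND_le => [|psi ns /in_F_rotA u /u[a a1 ->] s]; first exact: sqr_ge0.
exists N; rewrite qa_s0_rotA sqmod_evolve_rotA ?sqmod1 // sum_kick.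
by rewrite (minn_idPr (strict_incr_ge _ s)).
Qed.

(** In a disturbing run the checkpoints may split the kick anywhere, so a bound below 1 uniform over
    all partial kicks is required for the supremum. *)
Lemma Re_zeta_bound N : exists2 c : RR, 0 <= c < 1 &
  forall k, (0 < k <= N)%N -> complex.Re (zeta ^+ k) ^+ 2 <= c.
Proof.
elim: N => [|N [c /andP[c0 c1] H]]; first by exists 0; rewrite ?lexx ?ltr01 // => -[].
have Hlt := Re_sq_lt1 (sqmodX N.+1 sqmod_zeta) (Im_zeta_exp (ltn0Sn N)).
exists (Num.max c (complex.Re (zeta ^+ N.+1) ^+ 2)).
  by rewrite le_max c0 gt_max c1.
move=> k /andP[k0]; rewrite leq_eqVlt => /orP[/eqP->|kN]; rewrite le_max ?lexx ?orbT //.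
by rewrite H // k0.
Qed.

Lemma f_D_kick_lt1 N : (0 < N)%N -> f_D rotA (kick N) < 1.
Proof.
move=> N0; have [c /andP[c0 c1] H] := Re_zeta_bound N.
apply: le_lt_trans c1; apply: f_D_le => // psi ns /in_F_rotA u /u[a a1 ->] s.
(* The first segment of positive length starts at position 0 and reads between 1 and N letters
   [true]. *)
have [n0|n0] := posnP (ns 0).
  right; exists 0%N; rewrite n0 sqmod_evolve_rotA // sum_kick H //.
  by have := s 0%N; lia.
left; rewrite qa_s0_rotA sqmod_evolve_rotA ?sqmod1 // sum_kick H //.
by lia.
Qed.

(** Shift the checkpoints by N. Only the first segment meets the kick, and there it acts on the
    initial vector, where recurrence costs half of c - mu; later segments read [false] in both
    words. *)
Lemma f_D_kick_gt (B : QA bool) mu : 0 <= mu -> mu < f_D B rest ->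
  exists2 N, (0 < N)%N & mu < f_D B (kick N).
Proof.
move=> mu0 /(f_D_gt_elim mu0)[psi [ns [c [u f s [muc H0 H]]]]].
have e0 : 0 < (c - mu) / 2 by lra.
have [N [N0 HN]] := unitary_recurrence (qa_U_unitary B true) (qa_s0_unit B) e0.
exists N => //; apply: (@lt_le_trans _ _ (c - (c - mu) / 2)); first by lra.
apply: (f_D_ge (psi := psi) (ns := fun i => N + ns i)%N) => //.
- by move=> i; rewrite ltn_add2l.
- rewrite evolve_kick braket_iter_adj; apply: le_trans (HN _ _).
    rewrite lerD2r -braket_iter_adj.
    by rewrite (evolve_const _ (a := false)) in H0.
  exact/unit_vec_iter/u/unitary_adj/qa_U_unitary.
- move=> i; apply: le_trans (_ : c <= _) ; first by lra.
  rewrite subnDl (@eq_evolve _ _ _ _ rest (ns i)) // => k _.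
  by rewrite /kick /rest; lia.
Qed.

(** Here the kick is felt at every checkpoint. Moving the powers of U_false to the left as adjoints
    gives a different unit vector for each [i], and the uniformity of [unitary_recurrence] provides
    one N for all. *)
Lemma f_ND_kick_gt (B : QA bool) mu : 0 <= mu -> mu < f_ND B rest ->
  exists2 N, (0 < N)%N & mu < f_ND B (kick N).
Proof.
move=> mu0 /(f_ND_gt_elim mu0)[psi [ns [c [u f s muc H]]]].
have e0 : 0 < (c - mu) / 2 by lra.
have [N [N0 HN]] := unitary_recurrence (qa_U_unitary B true) (qa_s0_unit B) e0.
exists N => //; apply: (@lt_le_trans _ _ (c - (c - mu) / 2)); first by lra.
apply: (f_ND_ge (psi := psi) (ns := fun i => N + ns i)%N) => //.
- by move=> i; rewrite ltn_add2l.
- move=> i; rewrite evolve_kick braket_iter_adj; apply: le_trans (HN _ _).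
    rewrite lerD2r -braket_iter_adj.
    by have := H i; rewrite (evolve_const _ (a := false)).
  exact/unit_vec_iter/u/unitary_adj/qa_U_unitary.
Qed.

(* The word false^n0 (true^N false^d)^r false^omega. *)
Definition kicks (n0 N d r : nat) : word bool := fun n =>
  [&& (n0 <= n)%N, (n < n0 + r * (N + d))%N & ((n - n0) %% (N + d) < N)%N].

Lemma kicks_block n0 N d r i k : (i < r)%N -> (k < N + d)%N ->
  kicks n0 N d r (n0 + i * (N + d) + k)%N = kick N k.
Proof.
move=> ir kN; rewrite /kicks /kick -addnA leq_addr addKn modnMDl modn_small //.
rewrite ltn_add2l (_ : (_ < _)%N) //.
apply: (@leq_trans (i.+1 * (N + d))); first by rewrite mulSn addnC ltn_add2r.
by rewrite leq_mul2r ir orbT.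
Qed.

Lemma kicks_tail n0 N d r n : (n0 + r * (N + d) <= n)%N -> kicks n0 N d r n = false.
Proof. by move=> H; rewrite /kicks (ltnNge n) H andbF. Qed.

Lemma sum_kicks n0 N d r n : (n0 + r * (N + d) <= n)%N ->
  (\sum_(k < n) kicks n0 N d r (0 + k) = N * r)%N.
Proof.
move=> /subnKC <-; rewrite big_split_ord /= [X in (_ + X)%N]big1 ?addn0; last first.
  by move=> k _; rewrite kicks_tail // add0n leq_addr.
suff G i : (i <= r)%N ->
    (\sum_(k < n0 + i * (N + d)) kicks n0 N d r (0 + k) = N * i)%N by apply: G.
elim: i => [_|i IH ir].
  rewrite mul0n addn0 muln0 big1 // => k _.
  by rewrite /kicks add0n leqNgt ltn_ord.
rewrite mulSnr addnA big_split_ord /= IH ?(ltnW ir) // mulnS addnC; congr addn.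
under eq_bigr do rewrite add0n kicks_block //.
by apply: etrans (sum_kick N (N + d)) _; lia.
Qed.

Lemma f_ND_kicks n0 N d r :
  f_ND rotA (kicks n0 N d r) <= complex.Re (zeta ^+ (N * r)) ^+ 2.
Proof.
apply: f_ND_le => [|psi ns /in_F_rotA u /u[a a1 ->] s]; first exact: sqr_ge0.
exists (n0 + r * (N + d))%N; rewrite qa_s0_rotA sqmod_evolve_rotA ?sqmod1 //.
by rewrite sum_kicks // strict_incr_ge.
Qed.

(* A disturbing run restarts from psi at each checkpoint, so the errors made by
   the successive kicks do not accumulate. *)
Lemma f_D_kicks_gt (B : QA bool) mu : 0 <= mu -> mu < f_D B rest ->
  exists n0 N d, (0 < N)%N /\ forall r, mu < f_D B (kicks n0 N d r).
Proof.
move=> mu0 /(f_D_gt_elim mu0)[psi [ns [c [u f s [muc H0 /(_ 0%N) H]]]]].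
have e0 : 0 < (c - mu) / 2 by lra.
(* Recurrence is taken at psi, not at the initial vector: each kick hits a freshly reset psi. *)
have [N [N0 HN]] := unitary_recurrence (qa_U_unitary B true) u e0.
(* The first gap of the accepting run: psi survives [d] letters [false], and this single gap is
   repeated forever. *)
pose d := (ns 1 - ns 0)%N; have d0 : (0 < d)%N by rewrite subn_gt0 s.
rewrite (evolve_const _ (a := false)) // in H.
exists (ns 0), N, d; split=> // r.
apply: (@lt_le_trans _ _ (c - (c - mu) / 2)); first by lra.
(* Checkpoints at both ends of each of the r blocks of length N + d, then every d letters. *)
pose ns' i := (ns 0 + minn i r * (N + d) + (i - r) * d)%N.
have lo i : (i <= r)%N -> ns' i = (ns 0 + i * (N + d))%N.
  by move=> ir; rewrite /ns' (minn_idPl ir) (eqP ir) mul0n addn0.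
have hi i : (r <= i)%N -> ns' i = (ns 0 + r * (N + d) + (i - r) * d)%N.
  by move=> ir; rewrite /ns' (minn_idPr ir).
have stepl i : (i < r)%N -> (ns' i.+1 = ns' i + (N + d))%N.
  by move=> ir; rewrite !lo ?(ltnW ir) // mulSnr addnA.
have steph i : (r <= i)%N -> (ns' i.+1 = ns' i + d)%N.
  by move=> ir; rewrite !hi ?(leqW ir) // subSn // mulSnr addnA.
apply: (f_D_ge (psi := psi) (ns := ns')) => //.
- by move=> i; case: (ltnP i r) => ir; [rewrite stepl | rewrite steph] => //; lia.
- rewrite lo // mul0n addn0 (@eq_evolve _ _ _ _ rest 0).
    by apply: le_trans H0; lra.
  by move=> k k0; rewrite /kicks add0n leqNgt k0.
- move=> i; case: (ltnP i r) => ir.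
    rewrite stepl // addKn (@eq_evolve _ _ _ _ (kick N) 0); last first.
      by move=> k kN; rewrite lo ?(ltnW ir) // kicks_block.
    rewrite evolve_kick braket_iter_adj; apply: le_trans (HN _ _).
      by rewrite lerD2r -braket_iter_adj.
    exact/unit_vec_iter/u/unitary_adj/qa_U_unitary.
  rewrite steph // addKn (evolve_const _ (a := false)).
    by apply: le_trans H; lra.
  by move=> k _; rewrite kicks_tail // hi // -addnA leq_addr.
Qed.

(** * The three separations *)

Theorem theorem7 :
  (forall lambda mu : RR, 0 < lambda < 1 -> 0 <= mu < 1 ->
     ~ class_subset (class_gt ND lambda) (class_gt D mu)) /\
  (forall lambda : RR, 0 <= lambda < 1 ->
     ~ class_subset (class_eq1 ND) (class_gt D lambda)) /\
  (forall lambda : RR, 0 <= lambda < 1 ->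
     ~ class_subset (class_eq1 D) (class_gt ND lambda)).
Proof.
split; [|split].
- move=> lambda mu l01 /andP[mu0 _].
  move=> /(_ _ _ (ex_intro _ rotA erefl))[B /funeqP E].
  have [|n0 [N [d [N0 HB]]]] := @f_D_kicks_gt B mu mu0.
    have : lang_gt D mu B rest by rewrite -E /lang_gt /= f_ND_rest; case/andP: l01.
    by [].
  (* N is fixed by B before r is chosen, so the powers considered are those of zeta^N. *)
  have [|r Hr] := exists_Re_sq_le l01 (sqmodX N sqmod_zeta).
    by move=> n n_gt0; rewrite -exprM Im_zeta_exp // muln_gt0 N0.
  have : lang_gt ND lambda rotA (kicks n0 N d r) by rewrite E; apply: HB.
  rewrite /lang_gt /= => /lt_le_trans/(_ (f_ND_kicks _ _ _ _)).
  by rewrite exprM ltNge Hr.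
(* With acceptance at value exactly 1, a single kick already expels the word. *)
- move=> lambda /andP[l0 _] /(_ _ _ (ex_intro _ rotA erefl))[B /funeqP E].
  have HB : lang_gt D lambda B rest by rewrite -E; apply: f_ND_rest.
  have [N N0 HN] := f_D_kick_gt l0 HB.
  have : lang_eq1 ND rotA (kick N) by rewrite E.
  by move=> H; have := f_ND_kick_lt1 N0; rewrite [f_ND _ _]H ltxx.
- move=> lambda /andP[l0 _] /(_ _ _ (ex_intro _ rotA erefl))[B /funeqP E].
  have HB : lang_gt ND lambda B rest by rewrite -E; apply: f_D_rest.
  have [N N0 HN] := f_ND_kick_gt l0 HB.
  have : lang_eq1 D rotA (kick N) by rewrite E.
  by move=> H; have := f_D_kick_lt1 N0; rewrite [f_D _ _]H ltxx.
Qed.
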